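(* Let $T$ be a unitary operator on a Hilbert space $H$ and let $a=(a_n)$ and $b=(b_m)$ be bounded sequences of scalars. If $a$ and $b$ belong to $\mathcal{WW}_1$, then for every $f\in H$ the averages $$\frac{1}{N^2}\sum_{n,m=1}^N a_n b_m T^{n+m}f$$ converge in the norm of $H$ as $N\to\infty$.
   Context: $\mathcal{WW}_1$ denotes the set of bounded sequences $a=(a_n)$ of (complex) scalars such that $\lim_{N}\frac{1}{N}\sum_{n=1}^N a_n e^{2\pi i n t}$ exists for each $t\in\mathbb{R}$. *)

(* Defs.v *)
From HB Require Import structures.
From mathcomp Require Import all_boot all_order all_algebra.
From mathcomp Require Import complex.
From mathcomp Require Import all_classical all_reals all_analysis.

Set Implicit Arguments.
Unset Strict Implicit.
Unset Printing Implicit Defensive.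

Import Order.TTheory GRing.Theory Num.Theory.
Import numFieldNormedType.Exports.

Local Open Scope classical_set_scope.
Local Open Scope ring_scope.
Local Open Scope complex_scope.

Definition expi (R : realType) (x : R) : R[i] := cos x +i* sin x.

(* Sequences are indexed from 1 in the averages below: the value [a 0] is
   never used, and it does not affect boundedness.  [R[i]^o] is the complex
   field as a normed module over itself; it only serves to find its topology. *)
Definition WW1 (R : realType) : set (nat -> R[i]) :=
  [set a | bounded_fun (a : nat -> R[i]^o) /\
    forall t : R,
      cvgn (fun N : nat =>
        N%:R^-1 * (\sum_(1 <= n < N.+1) a n * expi (2 * pi * n%:R * t))
        : R[i]^o)].

(* The norm of a complex Banach space [H] comes from the inner product [dot]
   ([dot] is linear in its first argument, conjugate-linear in the second). *)
Definition hilbert_norm (R : realType) (H : completeNormedModType R[i])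
    (dot : {dot H for Num.conj}) : Prop :=
  forall x : H, `|x| ^+ 2 = dot x x.

Definition adjoint (R : realType) (H : completeNormedModType R[i])
    (dot : {dot H for Num.conj}) (T S : H -> H) : Prop :=
  forall x y : H, dot (T x) y = dot x (S y).

Definition unitary (R : realType) (H : completeNormedModType R[i])
    (dot : {dot H for Num.conj}) (T : {linear H -> H}) : Prop :=
  exists S : H -> H, [/\ adjoint dot T S, S \o T = id & T \o S = id].

(* Main.v *)
Require Import Defs.
From HB Require Import structures.
From mathcomp Require Import all_boot all_order all_algebra.
From mathcomp Require Import complex.
From mathcomp Require Import all_classical all_reals all_analysis.
From mathcomp Require Import ring lra.

Set Implicit Arguments.
Unset Strict Implicit.
Unset Printing Implicit Defensive.

Import Order.TTheory GRing.Theory Num.Theory.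
Import numFieldNormedType.Exports.

Local Open Scope classical_set_scope.
Local Open Scope ring_scope.
Local Open Scope complex_scope.

(* By the spectral theorem the averages are [p_N(T) f], where
   [p_N = average a N * average b N] is a bounded sequence of trigonometric
   polynomials converging pointwise, and dominated convergence for the spectral
   measure of [f] gives a Cauchy sequence in [H].  The measure itself is avoided:
   as [T] is an isometry, [wave f N t = sum_(n < N) e(-nt) T^n f] is an
   approximate eigenvector of [T] for [e(t)], so by Parseval at the points [j/N]
   the functionals [spectral T f N] send [|p|^2] to [|p(T) f|^2] in the limit.
   A limit along an ultrafilter is defined on all bounded functions, is monotone
   and modular for min and max, and these properties suffice for Arzela's bounded
   convergence theorem for continuous functions on [0, 1]. *)

(** * Bounded convergence for modular functionals *)

(* Arzela's bounded convergence theorem, by Dini's theorem applied to minima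
   of near-optimal finite maxima of the tail: [L] needs no countable additivity. *)
Lemma bounded_convergence_modular (R : realType) (X : topologicalType)
    (K : set X) (C M : R) (L : (X -> R) -> R) (u : nat -> X -> R)
    (D := [set g : X -> R | forall t, 0 <= g t <= C]) :
  compact K -> 0 <= C -> 0 < M ->
  (forall g h, D g -> D h -> L (g \min h) + L (g \max h) = L g + L h) ->
  (forall g h, D g -> D h -> (forall t, g t <= h t) -> L g <= L h) ->
  (forall g e, D g -> (forall t, K t -> g t <= e) -> L g <= e * M) ->
  (forall k, D (u k)) -> (forall k, continuous (u k)) ->
  (forall t, K t -> u ^~ t @ \oo --> 0) ->
  forall e, 0 < e -> exists k, L (u k) <= e.
Proof.
move=> Kc C0 M0 Lmod Lmono Lsmall uD uC u0 e' e'0.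
(* One half of the allowed error pays for the near-optimal choices, the other for the Dini
   estimate. *)
pose e := e' / 2; have e0 : 0 < e by rewrite divr_gt0.
pose mx k l t := \big[Num.max/0]_(k <= j < l) u j t.
have mx_le k l t z : 0 <= z ->
    (forall j, (k <= j < l)%N -> u j t <= z) -> mx k l t <= z.
  move=> z0 H; rewrite /mx big_seq; apply: bigmax_le => // j.
  by rewrite mem_index_iota; exact: H.
have le_mx k l t j : (k <= j < l)%N -> u j t <= mx k l t.
  by move=> jkl; apply: le_bigmax_seq => //; rewrite mem_index_iota.
have mx_ge0 k l t : 0 <= mx k l t by exact: bigmax_ge_id.
have mxD k l : D (mx k l).
  move=> t; rewrite mx_ge0 mx_le// => j _.
  by have /andP[] := uD j t.
have mxC k l : continuous (mx k l).
  rewrite /mx; elim: (index_iota k l) => [|j r IH].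
    have -> : (fun t => \big[Num.max/0]_(j <- [::]) u j t) = cst 0.
      by apply/funext => t; rewrite big_nil.
    exact: cst_continuous.
  have -> : (fun t => \big[Num.max/0]_(i <- j :: r) u i t) =
     (u j \max (fun t => \big[Num.max/0]_(i <- r) u i t)).
    by apply/funext => t; rewrite big_cons.
  by apply: max_fun_continuous => //; exact: uC.
pose s k := sup (range (fun l => L (mx k l))).
have hs k : has_sup (range (fun l => L (mx k l))).
  split; first by exists (L (mx k 0%N)), 0%N.
  exists (C * M) => _ [l _ <-]; apply: Lsmall => // t _.
  by have /andP[] := mxD k l t.
have le_s k l : L (mx k l) <= s k.
  by apply: ub_le_sup; [case: (hs k) | exists l].
(* These slacks satisfy $d_0+\dots+d_k = e - d_k$, the total loss allowed in [Lm]. *)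
pose d (k : nat) : R := e / 2 ^+ k.+1.
have d0 k : 0 < d k by rewrite divr_gt0// exprn_gt0.
have /choice[l lP] : forall k, exists l, s k - d k < L (mx k l).
  by move=> k; have [_ [l _ <-] lP] := sup_adherent (d0 k) (hs k); exists l.
(* Running minima make the sequence decreasing, as Dini's theorem requires; [Lm] shows that little
   of [L] is lost. *)
pose m := fix m k := if k is k'.+1 then m k' \min mx k (l k) else mx 0 (l 0%N).
have mD k : D (m k).
  elim: k => [|k IH] /=; first exact: mxD.
  move=> t /=; have /andP[a1 a2] := IH t; have /andP[b1 b2] := mxD k.+1 (l k.+1) t.
  by rewrite le_min a1 b1/= ge_min a2.
have mC k : continuous (m k).
  elim: k => [|k IH] /=; first exact: mxC.
  by apply: min_fun_continuous => //; exact: mxC.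
have m_le k t : m k t <= mx k (l k) t.
  by case: k => [|k] //=; rewrite ge_min lexx orbT.
have m_dec t : {homo m ^~ t : i j / (i <= j)%N >-> j <= i}.
  by apply: homo_leq => [//| |k] /=; [exact: ge_trans | rewrite ge_min lexx].
(* The maximum of [m k] and [mx k.+1 (l k.+1)] lies below a tail maximum starting at [k], so its [L]
   is at most [s k]; by modularity the deficit from [s] grows by at most [d k.+1]. *)
have Lm k : s k - e + d k <= L (m k).
  elim: k => [|k IH].
    by rewrite /= (le_trans _ (ltW (lP 0%N)))// /d expr1; lra.
  have maxD : D (m k \max mx k.+1 (l k.+1)).
    move=> t /=; have /andP[a1 a2] := mD k t.
    have /andP[b1 b2] := mxD k.+1 (l k.+1) t.
    by rewrite le_max a1/= ge_max a2.
  have : L (m k \max mx k.+1 (l k.+1)) <= s k.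
    apply: (le_trans _ (le_s k (maxn (l k) (l k.+1)))).
    apply: Lmono => // t /=; rewrite ge_max; apply/andP; split.
      apply: (le_trans (m_le k t)); apply: mx_le => // j /andP[kj jl].
      by apply: le_mx; rewrite kj leq_max jl.
    apply: mx_le => // j /andP[kj jl].
    by apply: le_mx; rewrite (ltnW kj) leq_max jl orbT.
  have := Lmod _ _ (mD k) (mxD k.+1 (l k.+1)).
  have := lP k.+1.
  have : d k = d k.+1 + d k.+1.
    by rewrite /d [in RHS]exprSr invfM mulrA -splitr.
  by rewrite /=; lra.
(* Dini: near each point of [K] some [m k] is below [e / M], later ones stay below by monotonicity,
   and compactness yields one index for all of [K]. *)
have /compact_near_coveringP/(_ nat \oo
    (fun k t => m k t < e / M) _) : compact K by [].
case=> [t Kt|N _ HN].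
  have eM0 : 0 < e / M by rewrite divr_gt0.
  have [k mk] : exists k, m k t < e / M.
    have := u0 t Kt => /cvgrPdist_lt/(_ (e / M / 2)).
    case=> [|k _ Hk]; first by rewrite divr_gt0.
    exists k; apply: (le_lt_trans (m_le k t)).
    apply: (@le_lt_trans _ _ (e / M / 2)); last by lra.
    apply: mx_le => [|j /andP[kj _]]; first by rewrite ltW// divr_gt0.
    have := Hk j kj; rewrite /= sub0r normrN => /ltW.
    exact/le_trans/ler_norm.
  exists ([set x | m k x < e / M], [set j | (k <= j)%N]) => /=.
    split; last by exists k.
    have := mC k t => /cvgr_lt; apply; exact: mk.
  by move=> [x j] [/= mkx kj]; exact: le_lt_trans (m_dec x _ _ kj) mkx.
exists N; have : L (m N) <= e / M * M.
  by apply: Lsmall => // t Kt; apply/ltW/(HN N _ t Kt); rewrite /= leqnn.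
rewrite divfK ?gt_eqF// => LmN.
have : L (u N) <= L (mx N N.+1).
  by apply: Lmono => // t; apply: le_mx; rewrite leqnn ltnS leqnn.
have := le_s N N.+1; have := Lm N; have := d0 N.
have : e' = e + e by rewrite /e -splitr.
lra.
Qed.

(** * Characters and their orthogonality at the points $j/N$ *)

Section Character.
Context {R : realType}.
Implicit Types x y t : R.

Lemma expi0 : expi 0 = 1 :> R[i].
Proof. by rewrite /expi cos0 sin0. Qed.

Lemma expiD x y : expi (x + y) = expi x * expi y.
Proof. by apply/eqP; rewrite eq_complex /= cosD sinD addrC eqxx /= addrC. Qed.

Lemma normr_expi x : `|expi x| = 1.
Proof. by rewrite normc_def /= cos2Dsin2 sqrtr1. Qed.

Lemma conj_expi x : (expi x)^*%R = expi (- x).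
Proof.
have nz : expi x != 0 by rewrite -normr_eq0 normr_expi oner_neq0.
apply: (mulfI nz); rewrite -normCK normr_expi expr1n.
by rewrite -expiD subrr expi0.
Qed.

(** Normalised to period 1, so that the points $j/N$ give the $N$-th roots of unity. *)
Definition ee t := expi (2 * pi * t).

Lemma eeD x y : ee (x + y) = ee x * ee y.
Proof. by rewrite /ee mulrDr expiD. Qed.

Lemma ee0 : ee 0 = 1.
Proof. by rewrite /ee mulr0 expi0. Qed.

Lemma normr_ee x : `|ee x| = 1.
Proof. exact: normr_expi. Qed.

Lemma conj_ee x : (ee x)^*%R = ee (- x).
Proof. by rewrite /ee conj_expi mulrN. Qed.

Lemma eeX x n : ee (x * n%:R) = ee x ^+ n.
Proof.
elim: n => [|n IH]; first by rewrite mulr0 ee0.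
by rewrite exprS -natr1 mulrDr mulr1 eeD IH mulrC.
Qed.

Lemma ee1 : ee 1 = 1.
Proof.
apply/eqP; rewrite eq_complex /= mulr1 mulrC mulr_natr cos2pi eqxx /=.
by rewrite sin2pi.
Qed.

(** The real part is $1 - 2\sin^2(\pi t)$, and this sine is positive. *)
Lemma ee_neq1 t : 0 < t < 1 -> ee t != 1.
Proof.
move=> /andP[t0 t1]; rewrite eq_complex /= negb_and; apply/orP; left.
have -> : 2 * pi * t = (pi * t) *+ 2 by rewrite mulr_natl; lra.
rewrite cos_mulr2n cos2sin2.
have : 0 < sin (pi * t).
  by apply: sin_gt0_pi; rewrite mulr_gt0 ?pi_gt0//= gtr_pMr ?pi_gt0.
by move=> s0; apply/eqP => h; have := mulr_gt0 s0 s0; rewrite -expr2; lra.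
Qed.

Lemma ee_neq1_dist n m N : (n < N)%N -> (m < N)%N -> n != m ->
  ee ((n%:R - m%:R) / N%:R) != 1.
Proof.
(* Conjugation exchanges [n] and [m]; with $m < n$ the quotient lies strictly between 0 and 1. *)
wlog nm : n m / (m <= n)%N => [hw nN mN neq|nN _ neq].
  have [nm|/ltnW mn] := leqP m n; first exact: hw.
  have := hw m n mn mN nN; rewrite eq_sym => /(_ neq).
  rewrite -[ee _]conjCK conj_ee -mulNr opprB.
  by apply: contra => /eqP ->; rewrite rmorph1.
have N0 : (0 < N)%N by apply: leq_ltn_trans nN.
apply: ee_neq1; rewrite -natrB// ltr_pdivrMr ?ltr0n// mul1r ltr_nat.
rewrite divr_gt0 ?ltr0n ?subn_gt0 ?(ltn_neqAle m) 1?eq_sym ?neq//=.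
exact: leq_ltn_trans (leq_subr _ _) nN.
Qed.

(** Off the diagonal this is a full geometric sum of an $N$-th root of unity other than 1. *)
Lemma sum_ee n m N : (n < N)%N -> (m < N)%N ->
  \sum_(j < N) ee ((n%:R - m%:R) * (j%:R / N%:R)) = (n == m)%:R * N%:R.
Proof.
move=> nN mN; have N0 : (N%:R : R) != 0 by rewrite pnatr_eq0 -lt0n (leq_ltn_trans _ nN).
under eq_bigr do rewrite mulrCA mulrC eeX.
have [->|nm] := eqVneq.
  rewrite subrr mul0r ee0; under eq_bigr do rewrite expr1n.
  by rewrite sumr_const card_ord mul1r.
have z1 := ee_neq1_dist nN mN nm.
apply: (@mulfI _ (ee ((n%:R - m%:R) / N%:R) - 1)); first by rewrite subr_eq0.
rewrite -subrX1 -eeX mul0r mulr0 divfK//.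
(* [eeX] takes natural multiples only, so a negative difference is handled by conjugation. *)
have [le|/ltnW le] := leqP m n.
  by rewrite -natrB// -[X in ee X]mul1r eeX ee1 expr1n subrr.
rewrite -[n%:R - _]opprB -conj_ee -natrB// -[X in ee X]mul1r eeX ee1 expr1n rmorph1.
by rewrite subrr.
Qed.

End Character.

(** * The norm as a real number *)

Section RealNorm.
Context {R : realType} {V : normedModType R[i]}.
Implicit Types x y : V.

(* The norm of [V], an element of [R[i]], as a real number. *)
Definition nm x : R := complex.Re `|x|.

Lemma nmE x : (nm x)%:C = `|x|.
Proof. by rewrite /nm RRe_real// normr_real. Qed.

Lemma nm_ge0 x : 0 <= nm x.
Proof. by rewrite -lecR nmE normr_ge0. Qed.

Lemma nm_le x (r : R) : (nm x <= r) = (`|x| <= r%:C).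
Proof. by rewrite -nmE lecR. Qed.

Lemma nm_lt x (r : R) : (nm x < r) = (`|x| < r%:C).
Proof. by rewrite -nmE ltcR. Qed.

Lemma nm0 : nm 0 = 0.
Proof. by apply: complexI; rewrite nmE normr0. Qed.

Lemma nmN x : nm (- x) = nm x.
Proof. by rewrite /nm normrN. Qed.

Lemma nmD x y : nm (x + y) <= nm x + nm y.
Proof. by rewrite nm_le rmorphD/= !nmE ler_normD. Qed.

(** The difference of squares is at most $2cX + c^2$, and $2cX \le hX^2 + c^2/h$. The term linear in
    the norm is thus traded for a small multiple of its square, which Parseval can sum. *)
Lemma nm_distr_sqr x y (c h : R) : 0 < h -> nm (x - y) <= c ->
  `|nm x ^+ 2 - nm y ^+ 2| <= h * nm x ^+ 2 + (c ^+ 2 / h + c ^+ 2).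
Proof.
move=> h0 xyc; have c0 : 0 <= c := le_trans (nm_ge0 _) xyc.
have xy : nm x <= nm y + c.
  by rewrite -[x in nm x <= _](subrK y) addrC (le_trans (nmD _ _))// lerD2l.
have yx : nm y <= nm x + c.
  rewrite -[y in nm y <= _](subrK x) addrC (le_trans (nmD _ _))// lerD2l.
  by rewrite -nmN opprB.
have c2h : 2 * c * nm x <= h * nm x ^+ 2 + c ^+ 2 / h.
  have : 0 <= (h * nm x - c) ^+ 2 / h by rewrite divr_ge0 ?sqr_ge0 ?ltW.
  have -> : (h * nm x - c) ^+ 2 / h = h * nm x ^+ 2 + c ^+ 2 / h - 2 * c * nm x.
    by field; rewrite gt_eqF.
  by rewrite subr_ge0.
have := nm_ge0 x; have := nm_ge0 y; set X := nm x in xy yx c2h *.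
set Y := nm y in xy yx *; move=> Y0 X0.
have : `|X ^+ 2 - Y ^+ 2| <= 2 * c * X + c ^+ 2.
  by rewrite ler_norml; apply/andP; split; nra.
by lra.
Qed.

End RealNorm.

Lemma nmZ (R : realType) (V : normedModType R[i]) (c : R[i]) (x : V) :
  nm (c *: x) = nm (c : R[i]^o) * nm x.
Proof. by apply: complexI; rewrite rmorphM/= !nmE normrZ. Qed.

Lemma nm_sqr (R : realType) (c : R[i]) :
  nm (c : R[i]^o) ^+ 2 = complex.Re c ^+ 2 + complex.Im c ^+ 2.
Proof. by apply: complexI; rewrite add_Re2_Im2 rmorphXn/= nmE. Qed.

(** * Waves of an isometry and Parseval's identity *)

Section Isometry.
Context {R : realType} {H : completeNormedModType R[i]}.
Variables (dot : {dot H for Num.conj}) (T : {linear H -> H}).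
Hypothesis dot_norm : hilbert_norm dot.
Hypothesis T_isometry : forall x, `|T x| = `|x|.

Let dotZZ c d x y : dot (c *: x) (d *: y) = c * d^*%R * dot x y.
Proof. by rewrite linearZl_LR linearZr_LR/= mulrA. Qed.

Let dot_sum N (c : nat -> R[i]) (x : nat -> H) :
  dot (\sum_(n < N) c n *: x n) (\sum_(n < N) c n *: x n) =
  \sum_(n < N) \sum_(m < N) c n * (c m)^*%R * dot (x n) (x m).
Proof.
rewrite linear_sumlz; apply: eq_bigr => n _.
by rewrite linear_sumr; apply: eq_bigr => m _; exact: dotZZ.
Qed.

(** Expanding the inner products and summing over [j] first, [sum_ee] leaves only the diagonal. *)
Lemma parseval N (x : nat -> H) :
  \sum_(j < N) nm (\sum_(n < N) ee (- (n%:R * (j%:R / N%:R))) *: x n) ^+ 2 =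
  N%:R * \sum_(n < N) nm (x n) ^+ 2.
Proof.
apply: complexI; rewrite rmorphM rmorph_nat !rmorph_sum /=.
under eq_bigr => j _.
  rewrite rmorphXn /= nmE dot_norm.
  rewrite (dot_sum N (fun n => ee (- (n%:R * (j%:R / N%:R))))).
  under eq_bigr => n _.
    under eq_bigr => m _ do
      rewrite conj_ee opprK -eeD addrC -mulrBl.
    over.
  over.
rewrite exchange_big /= mulr_sumr; apply: eq_bigr => n _.
rewrite exchange_big /=; under eq_bigr => m _ do
  rewrite -mulr_suml sum_ee//.
rewrite (bigD1 n)//= eqxx mul1r big1 ?addr0 => [|m mn].
  by rewrite rmorphXn /= nmE dot_norm.
by rewrite -val_eqE/= in mn; rewrite (negbTE mn) !mul0r.
Qed.

Lemma norm_iter n x : `|iter n T x| = `|x|.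
Proof. by elim: n => //= n IH; rewrite T_isometry. Qed.

Definition wave x N (t : R) := \sum_(n < N) ee (- (n%:R * t)) *: iter n T x.

Lemma waveD x y N t : wave (x + y) N t = wave x N t + wave y N t.
Proof.
rewrite /wave -big_split /=; apply: eq_bigr => n _; rewrite -scalerDr.
by congr (_ *: _); elim: (n : nat) => //= k ->; rewrite linearD.
Qed.

Lemma waveZ c x N t : wave (c *: x) N t = c *: wave x N t.
Proof.
rewrite /wave scaler_sumr; apply: eq_bigr => n _.
rewrite scalerA [c * _]mulrC -scalerA.
by congr (_ *: _); elim: (n : nat) => //= k ->; rewrite linearZ.
Qed.

Lemma wave_parseval x N :
  \sum_(j < N) nm (wave x N (j%:R / N%:R)) ^+ 2 = N%:R ^+ 2 * nm x ^+ 2.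
Proof.
rewrite parseval; under eq_bigr do rewrite /nm norm_iter.
by rewrite sumr_const card_ord; ring.
Qed.

(** The difference telescopes to two boundary terms, each of norm [nm x]. *)
Lemma wave_shift x N t : nm (wave (T x) N t - ee t *: wave x N t) <= 2 * nm x.
Proof.
have -> : wave (T x) N t - ee t *: wave x N t =
    ee (t - N%:R * t) *: iter N T x - ee t *: x.
  rewrite /wave; elim: N => [|N IH].
    by rewrite !big_ord0 scaler0 mul0r !subr0 /= subrr.
  rewrite !big_ord_recr /= scalerDr opprD addrACA IH scalerA -eeD -iterSr.
  by rewrite addrC addrA subrK; congr (ee _ *: _ - _); rewrite -natr1; ring.
rewrite (le_trans (nmD _ _))// nmN !nmZ /nm !normr_ee norm_iter/= mul1r.
by lra.
Qed.

(** * Symbols and approximate spectral measures *)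

Section Symbol.
Variable f : H.

(* [wave f N t] is an approximate eigenvector of [T] with eigenvalue [ee t];
   [symbol y p] expresses that [y = P(T) f] and [p t = P (ee t)] for some
   polynomial [P]. *)
Definition symbol y (p : R -> R[i]) :=
  exists C : R, forall N t, nm (wave y N t - p t *: wave f N t) <= C.

Lemma symbol1 : symbol f (fun=> 1).
Proof. by exists 0 => N t; rewrite scale1r subrr nm0. Qed.

Lemma symbol0 : symbol 0 (fun=> 0).
Proof.
exists 0 => N t; rewrite scale0r subr0.
by have := waveZ 0 0 N t; rewrite !scale0r => ->; rewrite nm0.
Qed.

Lemma symbolD x y p q : symbol x p -> symbol y q ->
  symbol (x + y) (fun t => p t + q t).
Proof.
move=> [C HC] [D HD]; exists (C + D) => N t.
rewrite waveD scalerDl opprD addrACA (le_trans (nmD _ _))//.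
exact: lerD.
Qed.

Lemma symbolZ c x p : symbol x p -> symbol (c *: x) (fun t => c * p t).
Proof.
move=> [C HC]; exists (nm (c : R[i]^o) * C) => N t.
by rewrite waveZ -scalerA -scalerBr nmZ ler_wpM2l// nm_ge0.
Qed.

Lemma symbolB x y p q : symbol x p -> symbol y q ->
  symbol (x - y) (fun t => p t - q t).
Proof.
move=> xp /(symbolZ (-1)) yq; have := symbolD xp yq; rewrite scaleN1r.
by congr (symbol _ _); apply/funext => t; rewrite mulN1r.
Qed.

(** The boundary terms of [wave_shift] add [2 * nm x] to the error, uniformly in [N] and [t]. *)
Lemma symbolT x p : symbol x p -> symbol (T x) (fun t => ee t * p t).
Proof.
move=> [C HC]; exists (2 * nm x + C) => N t.
rewrite -scalerA -(subrK (ee t *: wave x N t) (wave (T x) N t)) -addrA.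
rewrite -scalerBr (le_trans (nmD _ _))// lerD ?wave_shift//.
by rewrite nmZ {1}/nm normr_ee mul1r HC.
Qed.

Lemma symbol_iter k : symbol (iter k T f) (fun t => ee t ^+ k).
Proof.
elim: k => [|k IH]; first exact: symbol1.
have /= := symbolT IH.
by congr (symbol _ _); apply/funext => t; rewrite exprS.
Qed.

Lemma symbol_sum I (r : seq I) (x : I -> H) (p : I -> R -> R[i]) :
  (forall i, symbol (x i) (p i)) ->
  symbol (\sum_(i <- r) x i) (fun t => \sum_(i <- r) p i t).
Proof.
move=> xp; elim: r => [|i r IH].
  rewrite big_nil (_ : (fun _ => _) = fun=> 0); first exact: symbol0.
  by apply/funext => t; rewrite big_nil.
rewrite big_cons; have := symbolD (xp i) IH.
by congr (symbol _ _); apply/funext => t; rewrite big_cons.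
Qed.

(* Discrete approximations of the spectral measure of [f]. *)
Definition spectral N (g : R -> R) :=
  (N%:R ^+ 2)^-1 * \sum_(j < N) g (j%:R / N%:R) *
    nm (wave f N (j%:R / N%:R)) ^+ 2.

(** By Parseval [nm y ^+ 2] is exactly the normalised sum of the squared waves of [y]; replacing
    these by the waves of [f] times [p] costs a bounded error per wave, negligible after division by
    $N^2$. *)
Lemma spectral_symbol y p : symbol y p ->
  spectral N (fun t => nm (p t : R[i]^o) ^+ 2) @[N --> \oo] --> nm y ^+ 2.
Proof.
move=> [C HC]; apply/cvgrPdist_le => e e0.
have C0 : 0 <= C := le_trans (nm_ge0 _) (HC 0%N 0).
(* The part of the error proportional to [h] is at most [e / 2]; the added 1 covers [y = 0]. *)
pose h := e / 2 / (nm y ^+ 2 + 1).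
have y1 : 0 < nm y ^+ 2 + 1 by rewrite ltr_wpDl ?sqr_ge0.
have h0 : 0 < h by rewrite /h !divr_gt0.
pose D := C ^+ 2 / h + C ^+ 2.
have D0 : 0 <= D by rewrite /D addr_ge0 ?divr_ge0 ?sqr_ge0 ?ltW.
(* For such [N], the constant [D] summed over [N] points and divided by $N^2$ is at most [e / 2]. *)
exists (Num.truncn (D / (e / 2))).+1 => // N /= DN.
have N0 : (0 : R) < N%:R by rewrite ltr0n (leq_ltn_trans _ DN).
have N2 : (0 : R) < N%:R ^+ 2 by rewrite exprn_gt0.
have -> : nm y ^+ 2 =
    (N%:R ^+ 2)^-1 * \sum_(j < N) nm (wave y N (j%:R / N%:R)) ^+ 2.
  by rewrite wave_parseval mulKf// gt_eqF.
rewrite /spectral -mulrBr -sumrB normrM gtr0_norm ?invr_gt0//.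
rewrite ler_pdivrMl// (le_trans (ler_norm_sum _ _ _))//.
apply: (@le_trans _ _ (\sum_(j < N)
    (h * nm (wave y N (j%:R / N%:R)) ^+ 2 + D))).
  apply: ler_sum => j _; rewrite -exprMn -nmZ.
  exact: nm_distr_sqr.
rewrite big_split /= -mulr_sumr wave_parseval sumr_const card_ord -mulr_natl.
have hy : h * nm y ^+ 2 <= e / 2.
  by rewrite /h -mulrA ler_piMr ?divr_ge0 ?ltW// mulrC ltr_pdivrMr//; lra.
have : D <= N%:R * (e / 2).
  rewrite -ler_pdivrMr ?divr_gt0// (le_trans (ltW (truncnS_gt _)))//.
  by rewrite ler_nat.
move=> DNe; rewrite expr2; nra.
Qed.

End Symbol.
End Isometry.

(** * Continuity of complex-valued functions *)

Section ComplexContinuity.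
Context {R : realType}.
Implicit Types p q : R -> R[i].

(** Coordinates reduce continuity to real functions, and the squared modulus is the sum of their
    squares. *)
Definition ccontinuous p :=
  continuous (fun t => complex.Re (p t)) /\
  continuous (fun t => complex.Im (p t)).

Lemma ccontinuous_cst c : ccontinuous (fun=> c).
Proof. by split => ?; exact: cvg_cst. Qed.

Lemma ccontinuousD p q : ccontinuous p -> ccontinuous q ->
  ccontinuous (fun t => p t + q t).
Proof.
move=> [pr pi] [qr qi]; split => t.
  rewrite (_ : (fun t => _) =
      (fun t => complex.Re (p t) + complex.Re (q t))).
    by apply: cvgD; [exact: pr|exact: qr].
  by apply/funext => s; case: (p s) (q s) => ? ? [].
rewrite (_ : (fun t => _) = (fun t => complex.Im (p t) + complex.Im (q t))).
  by apply: cvgD; [exact: pi|exact: qi].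
by apply/funext => s; case: (p s) (q s) => ? ? [].
Qed.

Lemma ccontinuousM p q : ccontinuous p -> ccontinuous q ->
  ccontinuous (fun t => p t * q t).
Proof.
move=> [pr pi] [qr qi]; split => t.
  rewrite (_ : (fun t => _) = (fun t =>
    complex.Re (p t) * complex.Re (q t) - complex.Im (p t) * complex.Im (q t))).
    by apply: cvgB; apply: cvgM; [exact: pr|exact: qr|exact: pi|exact: qi].
  by apply/funext => s; case: (p s) (q s) => ? ? [].
rewrite (_ : (fun t => _) = (fun t =>
  complex.Re (p t) * complex.Im (q t) + complex.Im (p t) * complex.Re (q t))).
  by apply: cvgD; apply: cvgM; [exact: pr|exact: qi|exact: pi|exact: qr].
by apply/funext => s; case: (p s) (q s) => ? ? [].
Qed.

Lemma ccontinuousB p q : ccontinuous p -> ccontinuous q ->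
  ccontinuous (fun t => p t - q t).
Proof.
move=> pc qc; rewrite (_ : (fun t => _) = (fun t => p t + -1 * q t)).
  by apply: ccontinuousD => //; apply: ccontinuousM => //; exact: ccontinuous_cst.
by apply/funext => t; rewrite mulN1r.
Qed.

Lemma ccontinuous_sum I (r : seq I) (p : I -> R -> R[i]) :
  (forall i, ccontinuous (p i)) -> ccontinuous (fun t => \sum_(i <- r) p i t).
Proof.
move=> pc; elim: r => [|i r IH].
  rewrite (_ : (fun _ => _) = fun=> 0); first exact: ccontinuous_cst.
  by apply/funext => t; rewrite big_nil.
rewrite (_ : (fun _ => _) = fun t => p i t + \sum_(j <- r) p j t).
  exact: ccontinuousD.
by apply/funext => t; rewrite big_cons.
Qed.

Lemma ccontinuous_ee : ccontinuous ee.
Proof.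
split => t; apply: (@continuous_comp _ _ _ (fun t => 2 * pi * t)).
- exact: mulrl_continuous.
- exact: continuous_cos.
- exact: mulrl_continuous.
- exact: continuous_sin.
Qed.

Lemma ccontinuousX p n : ccontinuous p -> ccontinuous (fun t => p t ^+ n).
Proof.
move=> pc; elim: n => [|n IH]; first exact: ccontinuous_cst.
rewrite (_ : (fun _ => _) = fun t => p t * p t ^+ n).
  exact: ccontinuousM.
by apply/funext => t; rewrite exprS.
Qed.

Lemma continuous_nm_sqr p : ccontinuous p ->
  continuous (fun t => nm (p t : R[i]^o) ^+ 2).
Proof.
move=> [pr pi] t.
rewrite (_ : (fun t => _) =
  (fun t => complex.Re (p t) ^+ 2 + complex.Im (p t) ^+ 2)).
  by apply: cvgD; rewrite expr2; apply: cvgM;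
    [exact: pr|exact: pr|exact: pi|exact: pi].
by apply/funext => s; exact: nm_sqr.
Qed.

End ComplexContinuity.

(** * Exponential averages of a bounded sequence *)

Section Average.
Context {R : realType}.
Implicit Types a : nat -> R[i].

Definition average a N (t : R) :=
  N%:R^-1 * \sum_(1 <= n < N.+1) a n * ee t ^+ n.

Lemma ccontinuous_average a N : ccontinuous (average a N).
Proof.
apply: ccontinuousM; first exact: ccontinuous_cst.
apply: ccontinuous_sum => n; apply: ccontinuousM; first exact: ccontinuous_cst.
exact/ccontinuousX/ccontinuous_ee.
Qed.

Lemma cvg_average a t : WW1 a -> cvgn (fun N => average a N t : R[i]^o).
Proof.
move=> [_ /(_ t)]; set u := fun N => _.
suff -> : u = average a ^~ t by [].
apply/funext => N; congr (_ * _); apply: eq_bigr => n _; congr (_ * _).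
by rewrite -eeX /ee mulrAC mulrA.
Qed.

Lemma average_bounded a : bounded_fun (a : nat -> R[i]^o) ->
  exists2 C : R[i], 0 <= C & forall N t, `|average a N t| <= C.
Proof.
move=> /pinfty_ex_gt0 [C C0 aC]; exists C; first exact: ltW.
(* For [N = 0] the average vanishes, since the inverse of 0 is 0. *)
move=> [|N] t; first by rewrite /average invr0 mul0r normr0 ltW.
rewrite /average normrM normfV normr_nat ler_pdivrMl ?ltr0n//.
rewrite (le_trans (ler_norm_sum _ _ _))//.
rewrite (@le_trans _ _ (\sum_(1 <= n < N.+2) C))//.
  apply: ler_sum => n _; rewrite normrM normrX normr_ee expr1n mulr1.
  exact: aC.
by rewrite big_const_nat subn1 iter_addr addr0 mulr_natl.
Qed.

End Average.

(** * Ultrafilter limits of the spectral functionals *)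

(** The image of [F] clusters at a point of the compact segment, and an ultrafilter converges to its
    cluster points. *)
Lemma ultra_cvg_bounded (R : realType) (I : Type) (F : set_system I) (m M : R)
    (u : I -> R) :
  UltraFilter F -> (forall i, m <= u i <= M) -> cvg (u @ F).
Proof.
move=> FU umM.
have [|l [_ ul]] := @segment_compact R m M (u @ F) (fmap_proper_filter u _).
  by apply: (@filterE _ F) => i; rewrite /= in_itv/= umM.
apply/cvg_ex; exists l => B /= lB.
have [//|FB] := in_ultra_setVsetC (u @^-1` B) FU.
by have [y [/= nBy By]] := ul (~` B) B FB lB.
Qed.

Section SpectralLimit.
Context {R : realType} {H : completeNormedModType R[i]}.
Variables (dot : {dot H for Num.conj}) (T : {linear H -> H}).
Hypothesis dot_norm : hilbert_norm dot.
Hypothesis T_isometry : forall x, `|T x| = `|x|.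
Variable f : H.

Lemma spectral_ge0 N g : (forall t, 0 <= g t) -> 0 <= spectral T f N g.
Proof.
move=> g0; rewrite mulr_ge0 ?invr_ge0 ?sqr_ge0// sumr_ge0// => j _.
by rewrite mulr_ge0 ?sqr_ge0.
Qed.

Lemma le_spectral N g h : (forall t, g t <= h t) ->
  spectral T f N g <= spectral T f N h.
Proof.
move=> gh; rewrite ler_wpM2l ?invr_ge0 ?sqr_ge0// ler_sum// => j _.
by rewrite ler_wpM2r ?sqr_ge0.
Qed.

(** The sample points $j/N$ lie in $[0,1)$, and by Parseval the total mass is [nm f ^+ 2] for
    positive [N]; for [N = 0] the sum is empty. *)
Lemma spectral_le N g e : 0 <= e -> (forall t, 0 <= t <= 1 -> g t <= e) ->
  spectral T f N g <= e * nm f ^+ 2.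
Proof.
case: N => [|N] e0 ge.
  by rewrite /spectral big_ord0 mulr0 mulr_ge0 ?sqr_ge0.
rewrite /spectral ler_pdivrMl ?exprn_gt0 ?ltr0n// mulrCA.
rewrite -(wave_parseval dot_norm T_isometry) mulr_sumr.
apply: ler_sum => j _; rewrite ler_wpM2r ?sqr_ge0// ge//.
by rewrite divr_ge0//= ler_pdivrMr ?ltr0n// mul1r ler_nat ltnW.
Qed.

Lemma spectral_minD N g h :
  spectral T f N (g \min h) + spectral T f N (g \max h) =
  spectral T f N g + spectral T f N h.
Proof.
rewrite /spectral -!mulrDr -!big_split /=; congr (_ * _).
by apply: eq_bigr => j _; rewrite -!mulrDl addr_min_max.
Qed.

Lemma spectral_bounded_convergence (C : R) (x : nat -> H)
    (p : nat -> R -> R[i]) :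
  (forall k, symbol T f (x k) (p k)) -> (forall k, ccontinuous (p k)) ->
  (forall k t, nm (p k t : R[i]^o) <= C) ->
  (forall t e, 0 < e -> \forall k \near \oo, nm (p k t : R[i]^o) < e) ->
  forall e, 0 < e -> exists k, nm (x k) <= e.
Proof.
move=> xp pC pbnd p0 e e0.
have C0 : 0 <= C := le_trans (nm_ge0 _) (pbnd 0%N 0).
(* An ultrafilter finer than the filter at infinity gives all bounded sequences a limit and keeps
   existing limits. *)
have [F [FU ooF]] := ultraFilterLemma eventually_filter.
pose L g := lim (spectral T f N g @[N --> F]).
pose D := [set g : R -> R | forall t, 0 <= g t <= C ^+ 2].
have Dge0 g : D g -> forall t, 0 <= g t by move=> gD t; have /andP[] := gD t.
have Dle g : D g -> forall t, g t <= C ^+ 2 by move=> gD t; have /andP[] := gD t.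
have Lcvg g : D g -> cvg (spectral T f N g @[N --> F]).
  move=> gD; apply: (@ultra_cvg_bounded _ _ _ 0 (C ^+ 2 * nm f ^+ 2)) => N.
  rewrite spectral_ge0/=; last exact: Dge0.
  by apply: spectral_le => [|t _]; [exact: sqr_ge0|exact: Dle].
have minD g h : D g -> D h -> D (g \min h).
  by move=> gD hD t; rewrite /= le_min ge_min !Dge0 ?Dle.
have maxD g h : D g -> D h -> D (g \max h).
  by move=> gD hD t; rewrite /= le_max ge_max !Dge0 ?Dle.
have symD k : D (fun t => nm (p k t : R[i]^o) ^+ 2).
  by move=> t; rewrite sqr_ge0/= ler_sqr ?nnegrE ?nm_ge0 ?pbnd.
(* The added 1 makes the mass bound positive even for [f = 0]. *)
have [|||g h gD hD|g h gD hD gh|g d gD gd|k|k|t _||k] :=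
  @bounded_convergence_modular R R `[0, 1]%classic (C ^+ 2)
  (nm f ^+ 2 + 1) L (fun k t => nm (p k t : R[i]^o) ^+ 2) _ _ _ _ _ _ _ _ _
  (e ^+ 2).
- exact: segment_compact.
- exact: sqr_ge0.
- by rewrite ltr_wpDl ?sqr_ge0.
- rewrite -!limD; try exact: Lcvg; try exact/Lcvg/minD; try exact/Lcvg/maxD.
  by congr (lim (_ @ F)); apply/funext => N /=; exact: spectral_minD.
- apply: ler_lim; [exact: Lcvg|exact: Lcvg|].
  by near=> N; exact: le_spectral.
- have d0 : 0 <= d.
    by rewrite (le_trans (Dge0 _ gD 0))// gd//= in_itv/= lexx ler01.
  apply: limr_le; first exact: Lcvg.
  near=> N; rewrite (@le_trans _ _ (d * nm f ^+ 2))//.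
    by apply: spectral_le => // t t01; apply: gd; rewrite /= in_itv/= t01.
  by rewrite ler_wpM2l// lerDl.
- exact: symD.
- exact: continuous_nm_sqr.
- apply/cvgrPdist_lt => d d0.
  have := p0 t (Num.sqrt d); rewrite sqrtr_gt0 => /(_ d0).
  apply: filterS => k pk; rewrite sub0r normrN ger0_norm ?sqr_ge0//.
  by rewrite -[ltRHS]sqr_sqrtr ?ltW// ltr_sqr ?nnegrE ?sqrtr_ge0 ?nm_ge0.
- by rewrite exprn_gt0.
(* By [spectral_symbol] the value of [L] at the squared modulus of [p k] is the squared norm of
   [x k]. *)
rewrite /L (_ : lim _ = nm (x k) ^+ 2).
  by rewrite ler_sqr ?nnegrE ?nm_ge0 ?(ltW e0)// => xe; exists k.
apply: cvg_lim => //; apply: cvg_trans; last first.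
  exact: (spectral_symbol dot_norm T_isometry (xp k)).
exact: cvg_app.
Unshelve. all: by end_near.
Qed.

End SpectralLimit.

(** * Convergence of the averages for a unitary operator *)

(** $\|Tx\|^2 = \langle Tx,Tx\rangle = \langle x,STx\rangle = \|x\|^2$. *)
Lemma unitary_isometry (R : realType) (H : completeNormedModType R[i])
    (dot : {dot H for Num.conj}) (T : {linear H -> H}) :
  hilbert_norm dot -> unitary dot T -> forall x, `|T x| = `|x|.
Proof.
move=> dot_norm [S [TS ST _]] x.
apply/eqP; rewrite -(@eqrXn2 _ 2)//; apply/eqP.
by rewrite !dot_norm TS; have /= -> := congr1 (@^~ x) ST.
Qed.

(* The criterion tests one difference per stage, as the bounded convergence
   argument yields a single good stage. *)
Lemma cvg_subsequence_diff (R : realType) (H : completeNormedModType R[i])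
    (x : nat -> H) :
  (forall N : nat -> nat, (forall k, (k <= N k)%N) ->
    forall e : R, 0 < e -> exists k, nm (x (N k) - x k) <= e) ->
  cvgn x.
Proof.
move=> xN; apply/cauchy_cvgP/cauchy_exP => e e0.
have eE : (complex.Re e)%:C = e by rewrite RRe_real// gtr0_real.
have r0 : 0 < complex.Re e by rewrite -ltcR eE.
suff [k Hk] : exists k, forall N, (k <= N)%N -> nm (x N - x k) < complex.Re e.
  exists (x k), k => // N /= kN.
  by rewrite -ball_normE /= distrC -eE -nm_lt; exact: Hk.
(* Otherwise each [k] has some [N k] beyond it at distance at least [complex.Re e], against the
   hypothesis at half that size. *)
apply: contrapT => /forallNP Hk.
have /choice[N HN] : forall k, exists N,
    (k <= N)%N /\ complex.Re e <= nm (x N - x k).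
  move=> k; have /existsNP[N /not_implyP[kN /negP]] := Hk k.
  by rewrite -leNgt => ?; exists N.
have [k] := xN N (fun k => (HN k).1) (complex.Re e / 2) (divr_gt0 r0 (ltr0Sn _ _)).
have := (HN k).2; lra.
Qed.

Theorem proposition8 (R : realType) (H : completeNormedModType R[i])
    (dot : {dot H for Num.conj}) (dot_norm : hilbert_norm dot)
    (T : {linear H -> H}) (T_unitary : unitary dot T)
    (a b : nat -> R[i])
    (a_bounded : bounded_fun (a : nat -> R[i]^o))
    (b_bounded : bounded_fun (b : nat -> R[i]^o))
    (a_WW1 : WW1 a) (b_WW1 : WW1 b) (f : H) :
  cvgn (fun N : nat =>
    (N%:R ^+ 2)^-1 *:
      (\sum_(1 <= n < N.+1) \sum_(1 <= m < N.+1)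
         (a n * b m) *: iter (n + m)%N T f)).
Proof.
have T_isometry := unitary_isometry dot_norm T_unitary.
set x := fun N => _; pose p N t := average a N t * average b N t.
(* The symbol of $T^{n+m}f$ is $e(t)^n e(t)^m$, so the double sum factors into the two averages. *)
have xp N : symbol T f (x N) (p N).
  have := symbolZ (N%:R ^+ 2)^-1 (symbol_sum (index_iota 1 N.+1) (fun n =>
    symbol_sum (index_iota 1 N.+1) (fun m =>
      symbolZ (a n * b m) (symbol_iter T_isometry f (n + m))))).
  congr (symbol _ _ _ _); apply/funext => t.
  rewrite /p /average mulrACA -expr2 exprVn; congr (_ * _).
  rewrite mulr_suml; apply: eq_bigr => n _; rewrite mulr_sumr.
  by apply: eq_bigr => m _; rewrite exprD mulrACA.
have pC N : ccontinuous (p N) by apply: ccontinuousM; exact: ccontinuous_average.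
have [A A0 aA] := average_bounded a_bounded.
have [B B0 bB] := average_bounded b_bounded.
have pAB N t : `|p N t| <= A * B by rewrite normrM ler_pM.
apply: cvg_subsequence_diff => N kN.
apply: (spectral_bounded_convergence dot_norm T_isometry
  (C := complex.Re (A * B + A * B)) (p := fun k t => p (N k) t - p k t)).
- by move=> k; exact: symbolB.
- by move=> k; exact: ccontinuousB.
- move=> k t; rewrite nm_le RRe_real ?ger0_real ?addr_ge0 ?mulr_ge0//.
  by rewrite (le_trans (ler_normB _ _))// lerD.
move=> t e e0.
(* As [N k] is at least [k], both [p (N k) t] and [p k t] approach the same limit [l]. *)
have /cvg_ex[/= l pl] : cvgn (fun k => p k t : R[i]^o).
  by apply: is_cvgM; exact: cvg_average.
have e2 : 0 < (e / 2)%:C by rewrite ltcR divr_gt0.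
have := pl => /cvgrPdist_lt/(_ _ e2)[k0 _ Hk].
exists k0 => // k /= k0k; rewrite nm_lt.
have -> : p (N k) t - p k t = (l - p k t) - (l - p (N k) t) by ring.
rewrite (le_lt_trans (ler_normB _ _))//.
have -> : e%:C = (e / 2)%:C + (e / 2)%:C by rewrite -rmorphD/= -splitr.
by rewrite ltrD// Hk//= (leq_trans k0k).
Qed.
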